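(* Suppose conditional exchangeability and positivity hold, with $\pi(\chi)\ge\underline\pi>0$ for all $\chi\in\mathscr X$, and suppose the losses are uniformly sub-Gaussian, i.e. $\|\ell(z,\xi)\|_{\psi_2}\le\sigma$ for all $z\in\mathcal X$. Then there is a universal constant $C_{\mathrm{IPW}}>0$ such that for every fixed $z\in\mathcal X$ and $\delta\in(0,1)$, $$\mathbb E_{\mathbb P^\star}[\ell(z,\xi)]-\mathbb E_{\hat{\mathbb P}_N}[\ell(z,\xi)]\le C_{\mathrm{IPW}}\,\frac{\sigma}{\underline\pi}\sqrt{\frac{\log(1/\delta)}{N}}$$ with probability at least $1-\delta$, where $\mathbb E_{\hat{\mathbb P}_N}[\ell(z,\xi)]$ denotes the inverse probability weighting estimator $\frac1N\sum_{n\in[N]}\frac{\mathbb I[S_n=1]}{\pi(\chi_n)}\ell(z,\xi_n)$.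
   Context: $\mathcal X\subseteq\mathbb R^{D_x}$ is a compact convex decision set and $\ell(x,\xi)=\max_{j\in[J]}\big(a_j(x)^\top\xi+b_j(x)\big)$ with $a_j,b_j$ affine in $x$. The uncertain parameter is $\xi=(\chi,\omega)$, where $\chi\in\mathscr X$ is always observed and $\omega$ is observed only if the candidate is selected. $S\in\{0,1\}$ denotes the selection outcome; $\overline{\mathbb P}$ is the joint law of $(S,\chi,\omega)$ and $\mathbb P^\star$ is its marginal law of $\xi=(\chi,\omega)$. The logging policy is $\pi(\chi)=\overline{\mathbb P}(S=1\mid\chi)$. Conditional exchangeability: $\omega$ is independent of $S$ conditionally on $\chi$. Positivity: $\pi(\chi)\ge\underline\pi>0$ for all $\chi\in\mathscr X$. The data $(S_n,\chi_n,\omega_n)$, $n\in[N]$, are i.i.d. from $\overline{\mathbb P}$, with $\xi_n=(\chi_n,\omega_n)$ and $\omega_n$ observed only when $S_n=1$. $\mathbb I[\cdot]$ is the indicator, and $\|X\|_{\psi_2}=\inf\{c>0:\mathbb E[\exp((|X|/c)^2)-1]\le1\}$ (here under $\xi\sim\mathbb P^\star$). Probability refers to the sample. *)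

(* Defs.v *)
From HB Require Import structures.
From mathcomp Require Import all_boot all_order all_algebra.
From mathcomp Require Import all_classical all_reals all_analysis.

Set Implicit Arguments.
Unset Strict Implicit.
Unset Printing Implicit Defensive.

Import Order.TTheory GRing.Theory Num.Theory.
Import numFieldNormedType.Exports.

Local Open Scope classical_set_scope.
Local Open Scope ring_scope.

Definition is_affine (R : realType) (U V : lmodType R) (f : U -> V) : Prop :=
  exists (L : {linear U -> V}) (c : V), forall x, f x = L x + c.

(* The random vectors [chi] and [omega] are tuples of reals, because tuples
   carry the Borel (product) sigma-algebra in the library.  An outcome is the
   triple (S, (chi, omega)), where [S = true] encodes the selection S = 1. *)
Notation uncertainty R p q := (p.-tuple R * q.-tuple R)%type.
Notation outcome R p q := (bool * uncertainty R p q)%type.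

Definition sel (R : realType) (p q : nat) (y : outcome R p q) : bool := y.1.

Definition xi_of (R : realType) (p q : nat) (y : outcome R p q) :
  uncertainty R p q := y.2.

Definition chi_of (R : realType) (p q : nat) (y : outcome R p q) :
  p.-tuple R := y.2.1.

Definition omega_of (R : realType) (p q : nat) (y : outcome R p q) :
  q.-tuple R := y.2.2.

Fact measurable_xi_of (R : realType) (p q : nat) :
  measurable_fun [set: outcome R p q] (@xi_of R p q).
Proof. exact: measurable_snd. Qed.

HB.instance Definition _ (R : realType) (p q : nat) :=
  isMeasurableFun.Build _ _ _ _ (@xi_of R p q) (@measurable_xi_of R p q).

Definition xi_vec (R : realType) (p q : nat) (u : uncertainty R p q) :
  'cV[R]_(p + q) := \col_i tnth (cat_tuple u.1 u.2) i.

(* The maximum runs over J.+1 pieces, so that it is never empty; its seed is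
   one of the pieces and hence does not affect the value. *)
Definition max_affine_loss (R : realType) (Dx p q J : nat)
    (a : 'I_J.+1 -> 'cV[R]_Dx -> 'cV[R]_(p + q))
    (b : 'I_J.+1 -> 'cV[R]_Dx -> R)
    (x : 'cV[R]_Dx) (u : uncertainty R p q) : R :=
  let piece (j : 'I_J.+1) := ((a j x)^T *m xi_vec u) ord0 ord0 + b j x in
  \big[Num.max/piece ord0]_(j < J.+1) piece j.

(* +oo when the defining set is empty, i.e. when X is not sub-Gaussian. *)
Definition psi2_norm (d : measure_display) (T : measurableType d)
    (R : realType) (P : probability T R) (X : T -> R) : \bar R :=
  ereal_inf [set c%:E | c in
    [set c : R | 0 < c /\
      ('E_P[(fun t => (expR ((`|X t| / c) ^+ 2) - 1)%R)] <= 1)%E]].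

(* [f (Z _)] is a version of the conditional probability P(E | Z). *)
Definition is_cond_prob (d d' : measure_display) (T : measurableType d)
    (T' : measurableType d') (R : realType) (P : probability T R)
    (E : set T) (Z : T -> T') (f : T' -> R) : Prop :=
  measurable_fun [set: T'] f /\
  forall B : set T', measurable B ->
    (\int[P]_(t in Z @^-1` B) (f (Z t))%:E = P (E `&` Z @^-1` B))%E.

(* P(X \in A, Y \in B | Z) = P(X \in A | Z) P(Y \in B | Z) almost surely.
   Versions always exist and are almost surely unique, so it does not matter
   which ones are taken. *)
Definition cond_independent (d d1 d2 d3 : measure_display)
    (T : measurableType d) (T1 : measurableType d1) (T2 : measurableType d2)
    (T3 : measurableType d3) (R : realType) (P : probability T R)
    (X : T -> T1) (Y : T -> T2) (Z : T -> T3) : Prop :=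
  forall (A : set T1) (B : set T2), measurable A -> measurable B ->
    exists f g : T3 -> R,
      [/\ is_cond_prob P (X @^-1` A) Z f,
          is_cond_prob P (Y @^-1` B) Z g
        & is_cond_prob P (X @^-1` A `&` Y @^-1` B) Z (fun z => f z * g z)].

Definition mutually_independent (d d' : measure_display)
    (T : measurableType d) (T' : measurableType d') (R : realType)
    (P : probability T R) (N : nat) (X : 'I_N -> {RV P >-> T'}) : Prop :=
  forall (K : {set 'I_N}) (A : 'I_N -> set T'),
    (forall n, measurable (A n)) ->
    (P (\bigcap_(n in [set n | n \in K]) (X n @^-1` A n)) =
     \prod_(n in K) P (X n @^-1` A n))%E.

Definition iid_sample (d d' : measure_display)
    (T : measurableType d) (T' : measurableType d') (R : realType)
    (P : probability T R) (Q : probability T' R) (N : nat)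
    (X : 'I_N -> {RV P >-> T'}) : Prop :=
  mutually_independent X /\
  forall n (A : set T'), measurable A -> distribution P (X n) A = Q A.

Definition ipw_estimator (R : realType) (p q N : nat)
    (pol : p.-tuple R -> R) (y : 'I_N -> outcome R p q)
    (f : uncertainty R p q -> R) : R :=
  N%:R^-1 * \sum_(n < N)
    ((sel (y n) == true)%:R / pol (chi_of (y n)) * f (xi_of (y n))).

(* Main.v *)
Require Import Defs.
From HB Require Import structures.
From mathcomp Require Import all_boot all_order all_algebra.
From mathcomp Require Import all_classical all_reals all_analysis.
From mathcomp Require Import measurable_realfun.
From mathcomp Require Import ring lra.

Set Implicit Arguments.
Unset Strict Implicit.
Unset Printing Implicit Defensive.

Import Order.TTheory GRing.Theory Num.Theory.
Import numFieldNormedType.Exports.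

Local Open Scope classical_set_scope.
Local Open Scope ring_scope.

(** Write Y for the weighted loss [sel / pol (chi) * l (xi)] of one
outcome, and c for any constant above sigma.

Y has the right mean. On a rectangle [chi in C, omega in A], conditional
independence replaces the conditional probability of [omega in A, S = 1] by
the product of a version of P(omega in A | chi) and a version of the logging
policy; the weight 1 / pol cancels the latter. Rectangles generate the
product sigma-algebra, so the identity extends to all measurable functions of
(chi, omega) ([ipw_unbiased]).

Y is sub-Gaussian. The weight is almost surely at most 1 / pi_low, so Y
divided by c / pi_low is dominated by l / c and inherits the bound
E exp((l / c)^2) <= 2 ([ipw_term_subgaussian]). For a variable f with
E exp(f^2) <= 2, a pointwise bound of exp(u (E f - f)) by a combination of 1,
f and exp(f^2) gives the moment generating function bound exp(9 u^2)
([subgaussian_mgf]). It is free of a multiplicative constant, which is what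
makes the final bound valid for delta close to 1.

The exponential moments of a sample mean factor by independence
([expectation_prod]), and the exponential Markov inequality yields the tail
exp(- N x^2 / 36) for deviations x ([subgaussian_sample_mean_tail]). The
choice x = 6 sqrt(log(1/delta) / N) makes this tail equal to delta.

The psi_2-norm is an infimum, which is a priori not attained and may vanish,
so the bound is first obtained for each c > sigma. Letting c decrease
to sigma along a sequence, the good events decrease to the one for sigma, and
continuity of the measure from above concludes.

Three of these steps compare integrals against two weights: if W1 and W2 have
the same integral over each event [X in A], then phi(X) W1 and phi(X) W2 have
the same integral for each measurable phi >= 0 ([weighted_integral_ext]). *)

(** * Integrals against weights *)

Section weighted_integral.
Local Open Scope ereal_scope.
Context d d' (T : measurableType d) (T' : measurableType d') (R : realType).
Variables (mu : {measure set T -> \bar R}) (X : T -> T').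
Hypothesis mX : measurable_fun [set: T] X.

Import HBNNSimple.

Lemma weighted_integral_nnsfun (W : T -> \bar R) (g : {nnsfun T' >-> R}) :
  measurable_fun [set: T] W -> (forall t, 0 <= W t) ->
  \int[mu]_t ((g (X t))%:E * W t) =
  \sum_(r \in range g) (r%:E * \int[mu]_(t in X @^-1` (g @^-1` [set r])) W t).
Proof.
move=> mW W0.
have mpre r : measurable (X @^-1` (g @^-1` [set r])).
  by rewrite -[_ @^-1` _]setTI; exact: mX.
have mterm r : measurable_fun [set: T]
    (fun t => (\1_(X @^-1` (g @^-1` [set r])) t)%:E * W t).
  apply: emeasurable_funM => //; apply/measurable_EFinP.
  exact: measurable_indic.
transitivity (\int[mu]_t (\sum_(r \in range g)
    (r%:E * ((\1_(X @^-1` (g @^-1` [set r])) t)%:E * W t)))).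
  apply: eq_integral => t _; rewrite {1}fimfunE -fsumEFin//.
  rewrite ge0_mule_fsuml; last by move=> r; exact: nnfun_muleindic_ge0.
  by apply: eq_fsbigr => r _; rewrite EFinM muleA.
have ge0 r t : 0 <= r%:E * ((\1_(X @^-1` (g @^-1` [set r])) t)%:E * W t).
  by rewrite muleA mule_ge0//; exact: (nnfun_muleindic_ge0 g r (X t)).
rewrite ge0_integral_fsum//; last by move=> r; exact: measurable_funeM.
apply: eq_fsbigr => r; rewrite inE => -[y _ <-].
rewrite ge0_integralZl//; last 2 first.
- by move=> t _; rewrite mule_ge0// lee_fin.
- by rewrite lee_fin.
congr (_ * _); rewrite [RHS]integral_mkcond; apply: eq_integral => t _.
by rewrite epatch_indic muleC.
Qed.

(** Approximating [phi] from below by simple functions reduces the claim, by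
monotone convergence, to finite sums of the integrals in the hypothesis. *)
Lemma weighted_integral_ext (W1 W2 : T -> \bar R) (phi : T' -> \bar R) :
  measurable_fun [set: T] W1 -> (forall t, 0 <= W1 t) ->
  measurable_fun [set: T] W2 -> (forall t, 0 <= W2 t) ->
  measurable_fun [set: T'] phi -> (forall y, 0 <= phi y) ->
  (forall A, measurable A ->
    \int[mu]_(t in X @^-1` A) W1 t = \int[mu]_(t in X @^-1` A) W2 t) ->
  \int[mu]_t (phi (X t) * W1 t) = \int[mu]_t (phi (X t) * W2 t).
Proof.
move=> mW1 W10 mW2 W20 mphi phi0 W12.
pose g := nnsfun_approx measurableT mphi.
have cvgg y : (g n y)%:E @[n --> \oo] --> phi y.
  by apply: (@cvg_nnsfun_approx _ _ _ _ measurableT _ mphi) => // z _.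
have gle n y : (g n y)%:E <= phi y.
  by rewrite /g nnsfun_approxE; apply: le_approx.
have ndg y : {homo (fun n => g n y) : m n / (m <= n)%N >-> (m <= n)%R}.
  by move=> m n mn; exact/lefP/nd_nnsfun_approx.
have approx (W : T -> \bar R) : measurable_fun [set: T] W ->
    (forall t, 0 <= W t) -> \int[mu]_t (phi (X t) * W t) =
    limn (fun n => \int[mu]_t ((g n (X t))%:E * W t)).
  move=> mW W0; rewrite -monotone_convergence//.
  - apply: eq_integral => t _; apply/esym/cvg_lim => //.
    (* a product that tends to zero may be of the form 0 * +oo, a case in
       which multiplication is not continuous *)
    have [prod0|prod_neq0] := eqVneq (phi (X t) * W t) 0.
      rewrite prod0 (_ : (fun _ => _) = cst 0); first exact: cvg_cst.
      apply/funext => n /=; apply/eqP; rewrite eq_le -[X in _ <= X]prod0.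
      by rewrite lee_wpmul2r// mule_ge0// lee_fin.
    apply: cvgeM; [exact: neq0_mule_def|exact: cvgg|exact: cvg_cst].
  - move=> n; apply: emeasurable_funM => //; apply/measurable_EFinP.
    exact: measurableT_comp.
  - by move=> n t _; rewrite mule_ge0// lee_fin.
  - by move=> t _ m n mn; rewrite lee_wpmul2r// lee_fin; exact: ndg.
rewrite !approx//; congr (limn _); apply/funext => n.
rewrite !weighted_integral_nnsfun//; apply: eq_fsbigr => r _; rewrite W12//.
Qed.
End weighted_integral.

Section weighted_integral_rectangle.
Local Open Scope ereal_scope.
Context d d1 d2 (T : measurableType d) (T1 : measurableType d1)
  (T2 : measurableType d2) (R : realType).
Variables (mu : {measure set T -> \bar R}) (U : T -> T1) (V : T -> T2).
Hypotheses (mU : measurable_fun [set: T] U) (mV : measurable_fun [set: T] V).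

(** The events [(U, V) in A] on which the weights have equal integrals form a
Dynkin class in [A], and rectangles are a generating pi-system. Finiteness of
the total integral is what allows taking complements. *)
Lemma weighted_integral_rectangle (W1 W2 : T -> \bar R)
    (phi : T1 * T2 -> \bar R) :
  measurable_fun [set: T] W1 -> (forall t, 0 <= W1 t) ->
  measurable_fun [set: T] W2 -> (forall t, 0 <= W2 t) ->
  measurable_fun [set: T1 * T2] phi -> (forall y, 0 <= phi y) ->
  \int[mu]_t W2 t < +oo ->
  (forall A B, measurable A -> measurable B ->
    \int[mu]_(t in U @^-1` A `&` V @^-1` B) W1 t =
    \int[mu]_(t in U @^-1` A `&` V @^-1` B) W2 t) ->
  \int[mu]_t (phi (U t, V t) * W1 t) = \int[mu]_t (phi (U t, V t) * W2 t).
Proof.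
move=> mW1 W10 mW2 W20 mphi phi0 W2fin rect.
pose UV t := (U t, V t).
have mUV : measurable_fun [set: T] UV by exact: measurable_fun_pair.
have mpre A : measurable A -> measurable (UV @^-1` A).
  by move=> mA; rewrite -[_ @^-1` _]setTI; exact: mUV.
apply: (weighted_integral_ext mUV) => //.
rewrite measurable_prod_measurableType; apply: dynkin_induction => /=.
- by rewrite measurable_prod_measurableType.
- move=> _ _ [A1 mA1 [B1 mB1 <-]] [A2 mA2 [B2 mB2 <-]].
  exists (A1 `&` A2); first exact: measurableI.
  exists (B1 `&` B2); first exact: measurableI.
  by rewrite setXI.
- by have := rect _ _ measurableT measurableT; rewrite !preimage_setT setIT.
- by move=> _ [A mA [B mB <-]]; exact: rect.
- move=> A mA eqA.
  have split_int W : measurable_fun [set: T] W -> (forall t, 0 <= W t) ->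
      \int[mu]_t W t = \int[mu]_(t in UV @^-1` A) W t
                     + \int[mu]_(t in UV @^-1` (~` A)) W t.
    move=> mW W0; rewrite -ge0_integral_setU//.
    - by rewrite -preimage_setU setUv preimage_setT.
    - exact: mpre.
    - by apply: mpre; exact: measurableC.
    - exact: measurable_funTS.
    - by apply/disj_setPS; rewrite -preimage_setI setICr preimage_set0.
  have total : \int[mu]_t W1 t = \int[mu]_t W2 t.
    by have := rect _ _ measurableT measurableT; rewrite !preimage_setT setIT.
  have fin : \int[mu]_(t in UV @^-1` A) W2 t \is a fin_num.
    rewrite ge0_fin_numE; last exact: integral_ge0.
    apply: le_lt_trans W2fin; apply: ge0_subset_integral => //.
    exact: mpre.
  move: total; rewrite split_int// (split_int W2)// eqA.
  move=> /(congr1 (fun z => z - \int[mu]_(t in UV @^-1` A) W2 t)) /=.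
  by rewrite addeAC subee// add0e [X in _ = X -> _]addeAC subee// add0e.
- move=> F mF tF eqF.
  have tpre : trivIset [set: nat] (fun n => UV @^-1` F n).
    move/trivIsetP : tF => tF; apply/trivIsetP => i j _ _ ij.
    by rewrite -preimage_setI tF// preimage_set0.
  rewrite preimage_bigcup !ge0_integral_bigcup//.
  + by apply: eq_eseriesr => n _; exact: eqF.
  + by move=> n; exact: mpre.
  + exact: measurable_funTS.
  + by move=> n; exact: mpre.
  + exact: measurable_funTS.
Qed.
End weighted_integral_rectangle.

(** * Expectation of products of independent variables *)

Section independence.
Local Open Scope ereal_scope.
Context d d' (T : measurableType d) (T' : measurableType d') (R : realType).
Variables (P : probability T R) (N : nat) (X : 'I_N -> {RV P >-> T'}).
Hypothesis indepX : mutually_independent X.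

Let measurable_prod (Q : pred 'I_N) (phi : 'I_N -> T' -> \bar R) :
  (forall n, measurable_fun [set: T'] (phi n)) ->
  measurable_fun [set: T] (fun t => \prod_(n < N | Q n) phi n (X n t)).
Proof.
move=> mphi; rewrite /index_enum; elim: (Finite.enum _) => [|n s ih].
  by under eq_fun do rewrite big_nil; exact: measurable_cst.
under eq_fun do rewrite big_cons.
case: (Q n) => //; apply: emeasurable_funM => //.
exact: (measurableT_comp (mphi n)).
Qed.

Let prod_ge0 (Q : pred 'I_N) (u : 'I_N -> \bar R) :
  (forall n, 0 <= u n) -> 0 <= \prod_(n < N | Q n) u n.
Proof.
by move=> u0; elim/big_ind : _ => // x y x0 y0; exact: mule_ge0.
Qed.

Let expectation_prod_indic (A : 'I_N -> set T') :
  (forall n, measurable (A n)) ->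
  \int[P]_t (\prod_(n < N) (\1_(A n) (X n t))%:E) =
  \prod_(n < N) \int[P]_t (\1_(A n) (X n t))%:E.
Proof.
move=> mA; have mXA n : measurable (X n @^-1` A n) by exact: measurable_funPTI.
have prodE t : \prod_(n < N) (\1_(A n) (X n t))%:E =
    (\1_(\bigcap_(n in [set n | n \in [set: 'I_N]%SET])
            (X n @^-1` A n)) t)%:E :> \bar R.
  rewrite [in RHS]indicE; case: (boolP (t \in _)) => [|].
    rewrite inE => tA; rewrite big1// => n _; rewrite indicE mem_set//.
    by apply: tA; rewrite /= finset.inE.
  rewrite notin_setE /bigcap/= => /existsNP[n /not_implyP[_ tA]].
  by rewrite (bigD1 n)//= indicE memNset// mul0e.
under eq_integral do rewrite prodE.
rewrite integral_indic// ?setIT; last first.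
  by apply: fin_bigcap_measurable => //; exact: finite_finpred.
apply: etrans (indepX [set: 'I_N]%SET mA) _.
apply: eq_big => [n|n _]; first by rewrite finset.inE.
rewrite (eq_integral (fun t => (\1_(X n @^-1` A n) t)%:E))//.
by rewrite integral_indic// setIT.
Qed.

(** The indicators in the product are replaced by arbitrary functions one
coordinate at a time. At each step the product of the other coordinates is a
weight, compared with the constant weight equal to the product of the other
expectations. *)
Lemma expectation_prod (phi : 'I_N -> T' -> \bar R) :
  (forall n, measurable_fun [set: T'] (phi n)) ->
  (forall n y, 0 <= phi n y) ->
  \int[P]_t (\prod_(n < N) phi n (X n t)) =
  \prod_(n < N) \int[P]_t phi n (X n t).
Proof.
(* invariant: the coordinates from [k] on still carry indicators *)
suff main k : forall phi : 'I_N -> T' -> \bar R,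
    (forall n, measurable_fun [set: T'] (phi n)) ->
    (forall n y, 0 <= phi n y) ->
    (forall n : 'I_N, (k <= n)%N ->
      exists2 A, measurable A & phi n = (fun y => (\1_A y)%:E)) ->
    \int[P]_t (\prod_(n < N) phi n (X n t)) =
    \prod_(n < N) \int[P]_t phi n (X n t).
  move=> mphi phi0; apply: (main N) => // n.
  by rewrite leqNgt ltn_ord.
elim: k => [|k ih] {}phi mphi phi0 phi_indic.
  have /choice[A mA] : forall n, exists A, measurable A /\
      phi n = (fun y => (\1_A y)%:E).
    by move=> n; have [A mA ->] := phi_indic n (leq0n _); exists A.
  under eq_integral do under eq_bigr do rewrite (mA _).2.
  under [RHS]eq_bigr do under eq_integral do rewrite (mA _).2.
  by apply: expectation_prod_indic => n; exact: (mA n).1.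
have [kN|Nk] := ltnP k N; last first.
  by apply: ih => // n kn; have := ltn_ord n; rewrite ltnNge (leq_trans Nk).
pose i := Ordinal kN.
have mX n : measurable_fun [set: T] (phi n \o X n) by exact: measurableT_comp.
under eq_integral do rewrite (bigD1 i)//=.
have ge0_int n : 0 <= \int[P]_t phi n (X n t) by exact: integral_ge0.
rewrite (weighted_integral_ext (measurable_funP (X i))
  (W2 := fun=> \prod_(n < N | n != i) \int[P]_t phi n (X n t)))//=.
- rewrite [RHS](bigD1 i)//= ge0_integralZr//; last exact: prod_ge0.
  exact: (mX i).
- exact: measurable_prod.
- by move=> t; exact: prod_ge0.
- by move=> _; exact: prod_ge0.
move=> A mA; pose phi' n := if n == i then fun y => (\1_A y)%:E else phi n.
have phi'n n : n != i -> phi' n = phi n by rewrite /phi' => /negbTE ->.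
have restrictE (W : T -> \bar R) :
    \int[P]_(t in X i @^-1` A) W t = \int[P]_t (phi' i (X i t) * W t).
  rewrite integral_mkcond; apply: eq_integral => t _.
  by rewrite /phi' eqxx epatch_indic muleC.
have phi'0 n y : 0 <= phi' n y by rewrite /phi'; case: ifPn; rewrite ?lee_fin.
have mphi' n : measurable_fun [set: T'] (phi' n).
  rewrite /phi'; case: ifPn => // _; apply/measurable_EFinP.
  exact: measurable_indic.
rewrite !restrictE ge0_integralZr//; last 2 first.
- exact: (measurableT_comp (mphi' i)).
- exact: prod_ge0.
transitivity (\int[P]_t \prod_(n < N) phi' n (X n t)).
  apply: eq_integral => t _; rewrite [RHS](bigD1 i)//=; congr (_ * _).
  by apply: eq_bigr => n ni; rewrite phi'n.
rewrite ih//; last first.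
  move=> n kn; rewrite /phi'; case: eqVneq => [_|ni]; first by exists A.
  by apply: phi_indic; rewrite ltn_neqAle kn andbT eq_sym.
rewrite (bigD1 i)//=; congr (_ * _).
by apply: eq_bigr => n ni; rewrite phi'n.
Qed.

End independence.

(** * Moment generating functions of sub-Gaussian variables *)

Section subgaussian.
Context {R : realType}.
Implicit Types x l m f s : R.

(** The linear term has mean zero for a centred variable, and the rest is
quadratic in the exponent: this is the source of the sub-Gaussian moment
generating function. The constant 2 in the exponent allows an elementary
proof: up to 1/2 one compares with 1 / (1 - x), and beyond 1/2 one has
x <= 2 x^2. *)
Lemma expR_le_id_add_expR_sqr x : expR x <= x + expR (2 * x ^+ 2).
Proof.
have /= q1 := expR_ge1Dx (2 * x ^+ 2).
have x20 := sqr_ge0 x.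
have [x_le|x_gt] := lerP x (2^-1); last first.
  have : expR x <= expR (2 * x ^+ 2) by rewrite ler_expR; nra.
  by lra.
have inv_bound : expR x <= (1 - x)^-1.
  rewrite -[expR x]invrK -expRN lef_pV2 ?posrE ?expR_gt0//; last by lra.
  exact: expR_ge1Dx.
suff : (1 - x)^-1 <= 1 + x + 2 * x ^+ 2 by lra.
rewrite -[leLHS]mul1r ler_pdivrMr; last by lra.
have -> : (1 + x + 2 * x ^+ 2) * (1 - x) = 1 + x ^+ 2 * (1 - 2 * x) by ring.
by rewrite lerDl mulr_ge0//; lra.
Qed.

Lemma expR_le_chord (t s : R) : 0 <= t <= 1 ->
  expR (t * s) <= 1 + t * (expR s - 1).
Proof.
move=> /andP[t0 t1]; have := convex_expR (Itv01 t0 t1) s 0.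
rewrite !convRE/= expR0 mulr0 addr0 /unstable.onem => /le_trans; apply.
by rewrite le_eqVlt; apply/orP; left; apply/eqP; ring.
Qed.

(** The exponent 2 l^2 (m - f)^2 is at most 4 l^2 (m^2 + f^2), and as
4 l^2 <= 1 the chord bound makes the result affine in [expR (f ^+ 2)]. *)
Lemma expR_tilt_le_small l m f : m ^+ 2 <= 1 -> l ^+ 2 <= 4^-1 ->
  expR (l * (m - f)) <=
  l * (m - f) + expR (4 * l ^+ 2) * (1 + 4 * l ^+ 2 * (expR (f ^+ 2) - 1)).
Proof.
move=> m1 l4; apply: (le_trans (expR_le_id_add_expR_sqr _)); rewrite lerD2l.
apply: (@le_trans _ _ (expR (4 * l ^+ 2) * expR (4 * l ^+ 2 * f ^+ 2))).
  rewrite -expRD ler_expR.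
  have l0 := sqr_ge0 l.
  have := sqr_ge0 (m + f).
  by rewrite exprMn; nra.
rewrite ler_pM2l ?expR_gt0//; apply: expR_le_chord.
by rewrite mulr_ge0 ?sqr_ge0//=; lra.
Qed.

(** For large [l] the Gaussian factor absorbs any constant, so the weighted
inequality l (m - f) <= l^2 / 2 + m^2 + f^2 is enough. *)
Lemma expR_tilt_le_large l m f : m ^+ 2 <= 1 ->
  expR (l * (m - f)) <= expR (l ^+ 2 / 2 + 1) * expR (f ^+ 2).
Proof.
move=> m1; rewrite -expRD ler_expR.
have := sqr_ge0 (l / 2 - m); have := sqr_ge0 (l / 2 + f); nra.
Qed.

End subgaussian.

Section mgf.
Context d (T : measurableType d) (R : realType) (P : probability T R).
Implicit Types f g : T -> R.

Lemma integral_affine_comb f g (a b c : R) :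
  P.-integrable [set: T] (EFin \o f) -> P.-integrable [set: T] (EFin \o g) ->
  (\int[P]_t (a + b * f t + c * g t)%:E =
   a%:E + b%:E * \int[P]_t (f t)%:E + c%:E * \int[P]_t (g t)%:E)%E.
Proof.
move=> intf intg.
have intZ k h : P.-integrable [set: T] (EFin \o h) ->
    P.-integrable [set: T] (fun t => (k * h t)%:E).
  by move=> inth; under eq_fun do rewrite EFinM; exact: integrableZl.
have inta : P.-integrable [set: T] (fun=> a%:E).
  exact: finite_measure_integrable_cst.
under eq_integral do rewrite EFinD EFinD.
rewrite integralD//; [|by apply: integrableD => //; exact: intZ|exact: intZ].
rewrite integralD//; last exact: intZ.
rewrite integral_cst//= probability_setT mule1.
under eq_integral do rewrite EFinM; rewrite integralZl//.
by under [X in (_ + X)%E]eq_integral do rewrite EFinM; rewrite integralZl.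
Qed.

Lemma subgaussian_integrable f : measurable_fun [set: T] f ->
  (\int[P]_t (expR (f t ^+ 2))%:E <= 2%:E)%E ->
  P.-integrable [set: T] (EFin \o f) /\
  P.-integrable [set: T] (EFin \o (fun t => expR (f t ^+ 2))).
Proof.
move=> mf f2.
have mexp : measurable_fun [set: T] (fun t => expR (f t ^+ 2)).
  by apply: measurableT_comp => //; exact: measurable_funX.
have inte : P.-integrable [set: T] (EFin \o (fun t => expR (f t ^+ 2))).
  apply/integrableP; split; first exact/measurable_EFinP.
  under eq_integral do rewrite /= ger0_norm ?expR_ge0//.
  by rewrite (le_lt_trans f2)// ltry.
split=> //; apply: le_integrable inte => //; first exact/measurable_EFinP.
move=> t _; rewrite lee_fin/= [leRHS]ger0_norm ?expR_ge0//.
apply: le_trans (expR_ge1Dx _).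
have := real_normK (num_real (f t)); have := sqr_ge0 (`|f t| - 1); nra.
Qed.

(** Pointwise, 2 |f| <= 1 + f^2 <= exp(f^2). *)
Lemma subgaussian_mean f m : measurable_fun [set: T] f ->
  (\int[P]_t (expR (f t ^+ 2))%:E <= 2%:E)%E ->
  (\int[P]_t (f t)%:E)%E = m%:E -> m ^+ 2 <= 1.
Proof.
move=> mf f2 fm; have [intf inte] := subgaussian_integrable mf f2.
have fle t : `|f t| <= 2^-1 * expR (f t ^+ 2).
  have := expR_ge1Dx (f t ^+ 2); have := real_normK (num_real (f t)).
  have := sqr_ge0 (`|f t| - 1); nra.
suff m1 : `|m| <= 1 by rewrite -real_normK ?num_real// expr_le1.
rewrite -lee_fin -[leLHS]/(`|m%:E|)%E -fm.
apply: (le_trans (le_abse_integral _ _ _)) => //.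
  exact: (measurable_int P).
apply: (@le_trans _ _ (\int[P]_t (2^-1 * expR (f t ^+ 2))%:E)%E).
  apply: ge0_le_integral => //.
  - by apply: measurableT_comp => //; exact: (measurable_int P).
  - apply/measurable_EFinP; apply: measurable_funM => //.
    by apply/measurable_EFinP; exact: (measurable_int P).
  - by move=> t _; rewrite lee_fin.
under eq_integral do rewrite EFinM.
rewrite integralZl// (_ : 1%E = (2^-1)%:E * 2%:E)%E; last first.
  by rewrite -EFinM mulVf.
by rewrite lee_pmul2l ?lte_fin.
Qed.

(** Integrating the pointwise bounds above gives exp(8 l^2) when
l^2 <= 1/4, and 2 exp(l^2 / 2 + 1) <= exp(l^2 / 2 + 2) otherwise; both are at
most exp(9 l^2). *)
Lemma subgaussian_mgf f m l : measurable_fun [set: T] f ->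
  (\int[P]_t (expR (f t ^+ 2))%:E <= 2%:E)%E ->
  (\int[P]_t (f t)%:E)%E = m%:E ->
  (\int[P]_t (expR (l * (m - f t)))%:E <= (expR (9 * l ^+ 2))%:E)%E.
Proof.
move=> mf f2 fm; have [intf inte] := subgaussian_integrable mf f2.
have m2 := subgaussian_mean mf f2 fm.
have l20 := sqr_ge0 l.
have [e eE] : exists e, (\int[P]_t (expR (f t ^+ 2))%:E)%E = e%:E.
  exists (fine (\int[P]_t (expR (f t ^+ 2))%:E)%E).
  by rewrite fineK//; exact: integrable_fin_num inte.
move: f2; rewrite eE lee_fin => e2.
have bound a b c :
    (forall t, expR (l * (m - f t)) <= a + b * f t + c * expR (f t ^+ 2)) ->
    (\int[P]_t (expR (l * (m - f t)))%:E <= (a + b * m + c * e)%:E)%E.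
  move=> le_abc; rewrite !EFinD !EFinM -fm -eE -integral_affine_comb//.
  have mE : measurable_fun [set: T] (fun t => expR (f t ^+ 2)).
    by apply/measurable_EFinP; exact: (measurable_int P).
  apply: ge0_le_integral => //.
  - apply/measurable_EFinP; apply: measurableT_comp => //.
    by apply: measurable_funM => //; exact: measurable_funB.
  - apply/measurable_EFinP.
    by do 2 (apply: measurable_funD => //; last exact: measurable_funM).
  - by move=> t _; rewrite lee_fin.
have [l4|l4] := lerP (l ^+ 2) 4^-1.
  set E4 := expR (4 * l ^+ 2).
  apply: (le_trans (bound (l * m + E4 * (1 - 4 * l ^+ 2)) (- l)
    (E4 * (4 * l ^+ 2)) _)).
    move=> t; apply: le_trans (expR_tilt_le_small (f t) m2 l4) _; rewrite -/E4.
    by rewrite le_eqVlt; apply/orP; left; apply/eqP; ring.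
  rewrite lee_fin.
  have -> : 9 * l ^+ 2 = 4 * l ^+ 2 + 4 * l ^+ 2 + l ^+ 2 by ring.
  rewrite 2!expRD -/E4.
  have E40 : 0 < E4 by exact: expR_gt0.
  have E4ge : 1 + 4 * l ^+ 2 <= E4 by exact: expR_ge1Dx.
  apply: (@le_trans _ _ (E4 * E4)).
    have -> : l * m + E4 * (1 - 4 * l ^+ 2) + - l * m + E4 * (4 * l ^+ 2) * e =
        E4 * (1 + 4 * l ^+ 2 * (e - 1)) by ring.
    by rewrite ler_pM2l//; apply: le_trans E4ge; nra.
  rewrite ler_peMr ?mulr_ge0 ?expR_ge0//.
  by rewrite -expR0 ler_expR.
apply: (le_trans (bound 0 0 (expR (l ^+ 2 / 2 + 1)) _)).
  by move=> t; rewrite mul0r !add0r; exact: expR_tilt_le_large.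
rewrite lee_fin mul0r !add0r.
apply: (@le_trans _ _ (expR (l ^+ 2 / 2 + 1) * expR 1)).
  rewrite ler_pM2l ?expR_gt0//; have := expR_ge1Dx (1 : R); lra.
by rewrite -expRD ler_expR; lra.
Qed.

End mgf.

(** * Concentration of sample means *)

Section chernoff.
Local Open Scope ereal_scope.
Context d d' (T : measurableType d) (T' : measurableType d') (R : realType).
Variables (P : probability T R) (Q : probability T' R) (N : nat).
Variable D : 'I_N -> {RV P >-> T'}.
Hypothesis iidD : iid_sample Q D.

Lemma ge0_integral_sample n (phi : T' -> \bar R) :
  measurable_fun [set: T'] phi -> (forall y, 0 <= phi y) ->
  \int[P]_t phi (D n t) = \int[Q]_y phi y.
Proof.
move=> mphi phi0.
transitivity (\int[distribution P (D n)]_y phi y).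
  by rewrite ge0_integral_pushforward.
by apply: eq_measure_integral => A mA _; exact: iidD.2.
Qed.

(** Exponential Markov inequality at the parameter l = x / 18, which
minimizes 9 l^2 - l x. *)
Lemma subgaussian_sample_mean_tail (f : T' -> R) (m x : R) :
  (0 < N)%N -> measurable_fun [set: T'] f ->
  \int[Q]_y (expR (f y ^+ 2))%:E <= 2%:E ->
  \int[Q]_y (f y)%:E = m%:E -> (0 <= x)%R ->
  P [set t | x <= m - N%:R^-1 * \sum_(n < N) f (D n t)]%R <=
  (expR (- (N%:R * x ^+ 2 / 36)))%:E.
Proof.
move=> N0 mf f2 fm x0.
have NR0 : (0 < N%:R :> R)%R by rewrite ltr0n.
set A := [set t | _].
pose l : R := (x / 18)%R.
have mfD n : measurable_fun [set: T] (fun t => f (D n t)).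
  exact: measurableT_comp.
have mA : measurable A.
  rewrite -[A]setTI; apply: measurable_fun_le => //.
  apply: measurable_funB => //; apply: measurable_funM => //.
  exact: measurable_sum.
have mphi : measurable_fun [set: T'] (fun y => (expR (l * (m - f y)))%:E).
  apply/measurable_EFinP; apply: measurableT_comp => //.
  by apply: measurable_funM => //; exact: measurable_funB.
have prodE t : \prod_(n < N) (expR (l * (m - f (D n t))))%:E =
    (expR (\sum_(n < N) (l * (m - f (D n t)))))%:E.
  by rewrite expR_sum prodEFin.
have bound : (expR (l * (N%:R * x)))%:E * P A <= (expR (9 * l ^+ 2 * N%:R))%:E.
  apply: (@le_trans _ _
      (\int[P]_t (\prod_(n < N) (expR (l * (m - f (D n t))))%:E))).
    have -> : P A = \int[P]_t (\1_A t)%:E by rewrite integral_indic// setIT.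
    have m1A : measurable_fun [set: T] (fun t => (\1_A t)%:E : \bar R).
      by apply/measurable_EFinP; exact: measurable_indic.
    rewrite -ge0_integralZl//.
    apply: ge0_le_integral => //.
    - exact: measurable_funeM.
    - under eq_fun do rewrite prodE.
      apply/measurable_EFinP; apply: measurableT_comp => //.
      apply: measurable_sum => n; apply: measurable_funM => //.
      exact: measurable_funB.
    - move=> t _; rewrite prodE indicE; have [|] := boolP (t \in A).
        rewrite inE /A/= => tA; rewrite mule1 lee_fin ler_expR.
        rewrite -mulr_sumr sumrB sumr_const card_ord ler_wpM2l ?divr_ge0//.
        have := ler_wpM2l (ltW NR0) tA; rewrite mulrBr mulrA mulfV ?gt_eqF//.
        by rewrite mul1r -[(m *+ N)%R]mulr_natl.
      by move=> _; rewrite mulr0n mule0 lee_fin expR_ge0.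
  rewrite (expectation_prod iidD.1 (fun=> mphi))//.
  have -> : (expR (9 * l ^+ 2 * N%:R))%:E =
      \prod_(n < N) (expR (9 * l ^+ 2))%:E.
    by rewrite prodEFin prodr_const card_ord -expRM_natr.
  (* factorwise comparison of products also needs nonnegative factors, hence
     the strengthening to a two-sided bound *)
  apply: (@proj2
    (0 <= \prod_(n < N) \int[P]_t (expR (l * (m - f (D n t))))%:E)).
  apply/andP.
  elim/big_ind2 : _ => [|x1 x2 y1 y2 /andP[x10 x12] /andP[y10 y12]|n _].
  - by rewrite lee01 lexx.
  - by rewrite mule_ge0//= lee_pmul.
  - rewrite (ge0_integral_sample n mphi) => [|y]; last first.
      by rewrite lee_fin expR_ge0.
    rewrite subgaussian_mgf// andbT.
    by apply: integral_ge0 => y _; rewrite lee_fin expR_ge0.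
have -> : (- (N%:R * x ^+ 2 / 36) = 9 * l ^+ 2 * N%:R - l * (N%:R * x))%R.
  by rewrite /l; field.
by rewrite expRD expRN EFinM lee_pdivlMr ?expR_gt0// muleC.
Qed.
End chernoff.

(** * Inverse probability weighting *)

Lemma measurable_invr (R : realType) : measurable_fun [set: R] (@GRing.inv R).
Proof.
(* this form reduces the claim to powers of [`|x|]; at zero both sides vanish *)
have -> : @GRing.inv R = (fun x => x * (`|x| `^ (-1)) ^+ 2).
  apply/funext => x; rewrite powR_inv1// exprVn real_normK ?num_real//.
  have [->|x0] := eqVneq x 0; first by rewrite invr0 mul0r.
  by field.
apply: measurable_funM => //; apply: measurable_funX.
by apply: (measurableT_comp (measurable_powR (-1))).
Qed.

Section conditional_probability.
Local Open Scope ereal_scope.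
Context d d' (T : measurableType d) (T' : measurableType d') (R : realType).
Variables (P : probability T R) (Z : T -> T') (E : set T) (f : T' -> R).
Hypotheses (mZ : measurable_fun [set: T] Z) (mE : measurable E).
Hypothesis condf : is_cond_prob P E Z f.

(** On the event where the version is negative its integral is nonpositive,
yet it is the probability of an event. *)
Lemma cond_prob_ae_ge0 : {ae P, forall t, (0 <= f (Z t))%R}.
Proof.
have [mf intf] := condf.
pose B := f @^-1` `]-oo, 0%R[.
have mB : measurable B by rewrite -[B]setTI; exact: mf.
have mZB : measurable (Z @^-1` B) by rewrite -[_ @^-1` _]setTI; exact: mZ.
have mfZ : measurable_fun [set: T] (fun t => (f (Z t))%:E).
  by apply/measurable_EFinP; exact: measurableT_comp.
have fB t : (Z @^-1` B) t -> (f (Z t) < 0)%R by rewrite /B /= in_itv.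
have : \int[P]_(t in Z @^-1` B) `|(f (Z t))%:E| = 0.
  apply/eqP; rewrite eq_le integral_ge0// andbT.
  rewrite -oppe_ge0 -integral_ge0N//.
  rewrite (eq_integral (fun t => (f (Z t))%:E)); first by rewrite intf.
  by move=> t /[!inE] /fB ft0; rewrite /= ltr0_norm// opprK.
move/(ae_eq_integral_abs P mZB (measurable_funTS mfZ)).
apply: filterS => t ft0; rewrite leNgt; apply/negP => ft.
have /ft0[] : (Z @^-1` B) t by rewrite /B /= in_itv.
by move=> fZ0; rewrite fZ0 ltxx in ft.
Qed.

(** The absolute value keeps the integrand nonnegative everywhere; it changes
[f (Z t)] on a null set only. *)
Lemma integral_cond_prob (phi : T' -> \bar R) :
  measurable_fun [set: T'] phi -> (forall z, 0 <= phi z) ->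
  \int[P]_t (phi (Z t) * (\1_E t)%:E) =
  \int[P]_t (phi (Z t) * `|f (Z t)|%:E).
Proof.
move=> mphi phi0; have [mf intf] := condf.
have mfZ : measurable_fun [set: T] (fun t => f (Z t)).
  exact: measurableT_comp.
apply: (weighted_integral_ext mZ) => //.
- by apply/measurable_EFinP; exact: measurable_indic.
- by apply/measurable_EFinP; exact: measurableT_comp.
move=> A mA; rewrite integral_indic//; last first.
  by rewrite -[_ @^-1` _]setTI; exact: mZ.
apply: etrans (esym (intf A mA)) _; apply: ae_eq_integral => //.
- by rewrite -[_ @^-1` _]setTI; exact: mZ.
- by apply: measurable_funTS; exact/measurable_EFinP.
- by apply: measurable_funTS; apply/measurable_EFinP; exact: measurableT_comp.
apply: filterS cond_prob_ae_ge0 => t ft0 _.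
by rewrite ger0_norm.
Qed.
End conditional_probability.

Section inverse_probability_weighting.
Local Open Scope ereal_scope.
Context d d1 d2 d3 (T : measurableType d) (T1 : measurableType d1)
  (T2 : measurableType d2) (T3 : measurableType d3) (R : realType).
Variables (P : probability T R) (X : T -> T1) (Y : T -> T2) (Z : T -> T3).
Hypotheses (mX : measurable_fun [set: T] X) (mY : measurable_fun [set: T] Y)
  (mZ : measurable_fun [set: T] Z).
Hypothesis indepXY : cond_independent P X Y Z.
Variables (B : set T2) (pol : T3 -> R).
Hypotheses (mB : measurable B) (polP : is_cond_prob P (Y @^-1` B) Z pol).
Hypothesis pol_gt0 : {ae P, forall t, (0 < pol (Z t))%R}.

(** On a rectangle, conditioning on [Z] turns the indicator of [X] in [A] and
[Y] in [B] into a product [f * g] of versions. As [g] and [pol] are versions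
of the same conditional probability, [g] may be traded for the indicator of
[Y] in [B], and that indicator for [pol], which the weight cancels. *)
Lemma ge0_ipw_unbiased (phi : T3 * T1 -> \bar R) :
  measurable_fun [set: T3 * T1] phi -> (forall y, 0 <= phi y) ->
  \int[P]_t (phi (Z t, X t) * (\1_(Y @^-1` B) t / `|pol (Z t)|)%:E) =
  \int[P]_t phi (Z t, X t).
Proof.
move=> mphi phi0; have [mpol _] := polP.
have mYB : measurable (Y @^-1` B) by rewrite -[_ @^-1` _]setTI; exact: mY.
have minv : measurable_fun [set: T3] (fun z => `|pol z|^-1)%R.
  have mnorm : measurable_fun [set: T3] (fun z => `|pol z|)%R.
    exact: measurableT_comp.
  exact: (measurableT_comp (@measurable_invr R) mnorm).
have mminv : measurable_fun [set: T] (fun t => `|pol (Z t)|^-1)%R.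
  exact: (measurableT_comp minv).
have inv0 z : (0 <= `|pol z|^-1)%R by rewrite invr_ge0.
transitivity (\int[P]_t (phi (Z t, X t) * 1)); last first.
  by apply: eq_integral => t _; rewrite mule1.
apply: (weighted_integral_rectangle mZ mX) => //.
- by apply/measurable_EFinP; exact: measurable_funM.
- by rewrite integral_cst//= probability_setT mule1 ltry.
move=> C A mC mA.
have mXA : measurable (X @^-1` A) by rewrite -[_ @^-1` _]setTI; exact: mX.
have mZC : measurable (Z @^-1` C) by rewrite -[_ @^-1` _]setTI; exact: mZ.
have [f [g [fP gP fgP]]] := indepXY mA mB.
have [mf _] := fP.
have mabs (h : T3 -> R) : measurable_fun [set: T3] h ->
  measurable_fun [set: T3] (fun z => `|h z|%:E).
  by move=> mh; apply/measurable_EFinP; exact: measurableT_comp.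
have mind : measurable_fun [set: T3] (fun z => (\1_C z)%:E : \bar R).
  by apply/measurable_EFinP; exact: measurable_indic.
pose psi z : \bar R := (\1_C z)%:E * (`|pol z|^-1)%:E.
have mpsi : measurable_fun [set: T3] psi.
  by apply: emeasurable_funM => //; exact/measurable_EFinP.
have mindf : measurable_fun [set: T3] (fun z => (\1_C z)%:E * `|f z|%:E).
  by apply: emeasurable_funM => //; exact: mabs.
have mpsif : measurable_fun [set: T3] (fun z => psi z * `|f z|%:E).
  by apply: emeasurable_funM => //; exact: mabs.
have mpsifpol : measurable_fun [set: T3]
    (fun z => psi z * `|f z|%:E * `|pol z|%:E).
  by apply: emeasurable_funM => //; exact: mabs.
have psi0 z : 0 <= psi z by rewrite mule_ge0// lee_fin.
transitivity (\int[P]_t (psi (Z t) * (\1_(X @^-1` A `&` Y @^-1` B) t)%:E)).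
  rewrite integral_mkcond; apply: eq_integral => t _.
  rewrite epatch_indic /psi !indicI /= -[\1_C _]/(\1_(Z @^-1` C) t).
  by rewrite -!EFinM; congr (_%:E); ring.
rewrite (integral_cond_prob mZ _ fgP)//; last exact: measurableI.
transitivity (\int[P]_t ((psi (Z t) * `|f (Z t)|%:E) * (\1_(Y @^-1` B) t)%:E)).
  rewrite (integral_cond_prob mZ mYB gP (phi := fun z => psi z * `|f z|%:E)).
  - by apply: eq_integral => t _; rewrite normrM EFinM muleA.
  - by apply: emeasurable_funM => //; exact: mabs.
  - by move=> z; rewrite mule_ge0.
rewrite (integral_cond_prob mZ mYB polP (phi := fun z => psi z * `|f z|%:E)).
- transitivity (\int[P]_t ((\1_C (Z t))%:E * `|f (Z t)|%:E)).
    apply: ge0_ae_eq_integral => //.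
    + exact: (measurableT_comp mpsifpol mZ).
    + exact: (measurableT_comp mindf mZ).
    + by move=> t _; rewrite !mule_ge0.
    apply: filterS pol_gt0 => t pt _; rewrite /psi.
    rewrite -!EFinM; congr (_%:E).
    by field; rewrite normr_eq0 gt_eqF.
  rewrite -(integral_cond_prob mZ mXA fP (phi := fun z => (\1_C z)%:E))//.
  rewrite [RHS]integral_mkcond; apply: eq_integral => t _.
  by rewrite epatch_indic mul1e indicI /= EFinM.
- by apply: emeasurable_funM => //; exact: mabs.
- by move=> z; rewrite mule_ge0.
Qed.

(** The nonnegative case applies to both parts of [l], since a nonnegative
weight commutes with taking them. *)
Lemma ipw_unbiased (l : T3 * T1 -> R) : measurable_fun [set: T3 * T1] l ->
  \int[P]_t (\1_(Y @^-1` B) t / pol (Z t) * l (Z t, X t))%:E =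
  \int[P]_t (l (Z t, X t))%:E.
Proof.
move=> ml; have [mpol _] := polP.
have mYB : measurable (Y @^-1` B) by rewrite -[_ @^-1` _]setTI; exact: mY.
have mpolZ : measurable_fun [set: T] (fun t => pol (Z t)).
  exact: measurableT_comp.
have mw (u : T -> R) : measurable_fun [set: T] u ->
    measurable_fun [set: T] (fun t => \1_(Y @^-1` B) t / u t)%R.
  move=> mu; apply: measurable_funM; first exact: measurable_indic.
  exact: (measurableT_comp (@measurable_invr R) mu).
have mZX : measurable_fun [set: T] (fun t => (Z t, X t)).
  exact: measurable_fun_pair.
have mlZX : measurable_fun [set: T] (fun t => l (Z t, X t)).
  exact: (measurableT_comp ml mZX).
transitivity
    (\int[P]_t (\1_(Y @^-1` B) t / `|pol (Z t)| * l (Z t, X t))%:E).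
  apply: ae_eq_integral => //.
  - by apply/measurable_EFinP/measurable_funM => //; exact: mw.
  - apply/measurable_EFinP/measurable_funM => //; apply: mw.
    exact: measurableT_comp.
  - by apply: filterS pol_gt0 => t pt _; rewrite gtr0_norm.
have ipw phi := ge0_ipw_unbiased (phi := phi).
have w0 t : (0 <= \1_(Y @^-1` B) t / `|pol (Z t)|)%R by rewrite divr_ge0.
have mlE : measurable_fun [set: T3 * T1] (fun y => (l y)%:E).
  exact/measurable_EFinP.
rewrite integralE [RHS]integralE; congr (_ - _).
- under eq_integral do rewrite funeposE.
  under [RHS]eq_integral do rewrite funeposE.
  rewrite -(ipw (fun y => maxe (l y)%:E 0))//.
  + apply: eq_integral => t _.
    by rewrite maxe_pMl ?lee_fin// mul0e EFinM muleC.
  + exact: measurable_maxe.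
  + by move=> y; rewrite le_max lexx orbT.
- under eq_integral do rewrite funenegE.
  under [RHS]eq_integral do rewrite funenegE.
  rewrite -(ipw (fun y => maxe (- (l y)%:E) 0))//.
  + apply: eq_integral => t _.
    by rewrite maxe_pMl ?lee_fin// mul0e mulNe -EFinM mulrC.
  + by apply: measurable_maxe => //; exact: measurableT_comp.
  + by move=> y; rewrite le_max lexx orbT.
Qed.
End inverse_probability_weighting.

(** * Max-affine losses and the Orlicz norm *)

Section max_affine.
Context (R : realType) (Dx p q J : nat).
Variables (a : 'I_J.+1 -> 'cV[R]_Dx -> 'cV[R]_(p + q))
  (b : 'I_J.+1 -> 'cV[R]_Dx -> R).

Lemma measurable_xi_vec (i : 'I_(p + q)) :
  measurable_fun [set: uncertainty R p q] (fun u => xi_vec u i ord0).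
Proof.
under eq_fun do rewrite mxE.
have [k|k] := splitP i => ik.
- have -> : i = lshift q k by exact: val_inj.
  under eq_fun do rewrite tnth_lshift.
  exact: (measurableT_comp (measurable_tnth k) measurable_fst).
- have -> : i = rshift p k by exact: val_inj.
  under eq_fun do rewrite tnth_rshift.
  exact: (measurableT_comp (measurable_tnth k) measurable_snd).
Qed.

Lemma measurable_max_affine_loss (x : 'cV[R]_Dx) :
  measurable_fun [set: uncertainty R p q] (max_affine_loss a b x).
Proof.
have mpiece j : measurable_fun [set: uncertainty R p q]
    (fun u => ((a j x)^T *m xi_vec u) ord0 ord0 + b j x).
  apply: measurable_funD => //; under eq_fun do rewrite mxE.
  apply: measurable_sum => i; apply: measurable_funM => //.
  exact: measurable_xi_vec.
rewrite /max_affine_loss /index_enum.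
elim: (Finite.enum _) => [|j s ih].
  by under eq_fun do rewrite big_nil; exact: mpiece.
under eq_fun do rewrite big_cons.
exact: (measurable_maxr (mpiece j) ih).
Qed.
End max_affine.

Section orlicz.
Context d (T : measurableType d) (R : realType) (P : probability T R).

Lemma psi2_norm_ge0 (X : T -> R) : (0 <= psi2_norm P X)%E.
Proof.
by apply: le_ereal_inf_tmp => _ [c [c0 _] <-]; rewrite lee_fin ltW.
Qed.

(** The Orlicz condition is monotone in the constant, so it holds at each
constant above the infimum, even when the infimum is not attained. *)
Lemma psi2_norm_lt (X : T -> R) (s c0 : R) : measurable_fun [set: T] X ->
  (psi2_norm P X <= s%:E)%E -> s < c0 ->
  (\int[P]_t (expR ((X t / c0) ^+ 2))%:E <= 2%:E)%E.
Proof.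
move=> mX Xs sc0.
have : (psi2_norm P X < c0%:E)%E by rewrite (le_lt_trans Xs)// lte_fin.
move=> /ereal_inf_lt[_ [c [c_gt0 Ec] <-]]; rewrite lte_fin => cc0.
have mexp k : measurable_fun [set: T] (fun t => expR ((X t / k) ^+ 2)).
  apply: measurableT_comp => //; apply: measurable_funX.
  exact: measurable_funM.
have exp_ge1 t k : 1 <= expR ((X t / k) ^+ 2).
  by rewrite -expR0 ler_expR sqr_ge0.
apply: (@le_trans _ _ (\int[P]_t (expR ((X t / c) ^+ 2))%:E)%E).
  apply: ge0_le_integral => //.
  - exact/measurable_EFinP.
  - exact/measurable_EFinP.
  - move=> t _; rewrite lee_fin ler_expR.
    rewrite !exprMn ler_wpM2l ?sqr_ge0// !exprVn lef_pV2 ?posrE ?exprn_gt0//.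
      by rewrite ler_pXn2r ?nnegrE ?ltW//; exact: lt_trans cc0.
    exact: lt_trans cc0.
have -> : (\int[P]_t (expR ((X t / c) ^+ 2))%:E =
    \int[P]_t (expR ((X t / c) ^+ 2) - 1)%:E + 1%:E)%E.
  transitivity (\int[P]_t ((expR ((X t / c) ^+ 2) - 1)%:E + 1%:E))%E.
    by apply: eq_integral => t _; rewrite -EFinD subrK.
  rewrite ge0_integralD//.
  - by rewrite integral_cst//= probability_setT mule1.
  - by move=> t _; rewrite lee_fin subr_ge0.
  - by apply/measurable_EFinP; exact: measurable_funB.
rewrite (_ : 2%:E = 1 + 1%:E)%E// leeD2r//.
move: Ec; rewrite unlock; apply: le_trans.
by under [leRHS]eq_integral do
  rewrite expr_div_n real_normK ?num_real// -expr_div_n.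
Qed.
End orlicz.

(** * The weighted estimator *)

Section ipw_concentration.
Context (R : realType) (p q : nat).
Variables (Pbar : probability (outcome R p q) R) (pol : p.-tuple R -> R).
Variable pi_low : R.
Hypotheses (polP : is_cond_prob Pbar [set y | sel y = true] (@chi_of R p q) pol)
  (indep : cond_independent Pbar (@omega_of R p q) (@sel R p q) (@chi_of R p q))
  (pi_low_gt0 : 0 < pi_low)
  (pol_ge : {ae Pbar, forall y, pi_low <= pol (chi_of y)}).
Variable l : uncertainty R p q -> R.
Hypothesis ml : measurable_fun [set: uncertainty R p q] l.

Definition ipw_term (y : outcome R p q) : R :=
  (sel y == true)%:R / pol (chi_of y) * l (xi_of y).

Let mchi : measurable_fun [set: outcome R p q] (@chi_of R p q).
Proof. exact: (measurableT_comp measurable_fst measurable_snd). Qed.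

Let momega : measurable_fun [set: outcome R p q] (@omega_of R p q).
Proof. exact: (measurableT_comp measurable_snd measurable_snd). Qed.

Let msel : measurable_fun [set: outcome R p q] (@sel R p q).
Proof. exact: measurable_fst. Qed.

Let sel_indic y : (sel y == true)%:R = \1_(@sel R p q @^-1` [set true]) y :> R.
Proof.
rewrite indicE; congr (_%:R); congr nat_of_bool.
by apply/eqP/idP; rewrite inE.
Qed.

Lemma measurable_ipw_term : measurable_fun [set: outcome R p q] ipw_term.
Proof.
have [mpol _] := polP.
apply: measurable_funM; last exact: (measurableT_comp ml measurable_snd).
apply: measurable_funM.
  under eq_fun do rewrite sel_indic.
  apply: measurable_indic; rewrite -[_ @^-1` _]setTI; exact: msel.
have mpolchi : measurable_fun [set: outcome R p q] (fun y => pol (chi_of y)).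
  exact: (measurableT_comp mpol mchi).
exact: (measurableT_comp (@measurable_invr R) mpolchi).
Qed.

Lemma integral_ipw_term :
  (\int[Pbar]_y (ipw_term y)%:E = \int[Pbar]_y (l (xi_of y))%:E)%E.
Proof.
have pol_gt0 : {ae Pbar, forall y, 0 < pol (chi_of y)}.
  by apply: filterS pol_ge => y; exact: lt_le_trans.
have := ipw_unbiased momega msel mchi indep (B := [set true]) _ polP pol_gt0 ml.
have xiE y : (chi_of y, omega_of y) = xi_of y.
  by rewrite /xi_of; case: y => ? [].
under eq_integral do rewrite xiE -sel_indic.
under [in RHS]eq_integral do rewrite xiE.
by apply.
Qed.

(** Almost surely the weight of the loss, once multiplied by [pi_low], lies
in [0, 1]. *)
Lemma ipw_term_subgaussian (c : R) : 0 < c ->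
  (\int[Pbar]_y (expR ((l (xi_of y) / c) ^+ 2))%:E <= 2%:E)%E ->
  (\int[Pbar]_y (expR ((ipw_term y / (c / pi_low)) ^+ 2))%:E <= 2%:E)%E.
Proof.
move=> c0; apply: le_trans.
have mexp (h : outcome R p q -> R) k : measurable_fun [set: outcome R p q] h ->
    measurable_fun [set: outcome R p q] (fun y => (expR ((h y / k) ^+ 2))%:E).
  move=> mh; apply/measurable_EFinP; apply: measurableT_comp => //.
  by apply: measurable_funX; exact: measurable_funM.
apply: ae_ge0_le_integral => //.
- by apply: mexp; exact: measurable_ipw_term.
- by apply: mexp; exact: (measurableT_comp ml measurable_snd).
apply: filterS pol_ge => y py _; rewrite lee_fin ler_expR /ipw_term.
have pol0 : 0 < pol (chi_of y) by exact: lt_le_trans py.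
have -> : (sel y == true)%:R / pol (chi_of y) * l (xi_of y) / (c / pi_low) =
    (sel y == true)%:R * (pi_low / pol (chi_of y)) * (l (xi_of y) / c).
  by field; rewrite !gt_eqF.
rewrite exprMn ler_piMl ?sqr_ge0// expr_le1//; last first.
  by rewrite mulr_ge0// divr_ge0 ?ltW.
apply: mulr_ile1 => //; first by rewrite divr_ge0// ltW.
  by rewrite lern1 leq_b1.
by rewrite ler_pdivrMr// mul1r.
Qed.

Lemma measurable_ipw_estimator (d : measure_display)
    (Omega : measurableType d) (P : probability Omega R) (N : nat)
    (D : 'I_N -> {RV P >-> outcome R p q}) :
  measurable_fun [set: Omega]
    (fun w => ipw_estimator pol (fun n => D n w) l).
Proof.
apply: measurable_funM => //; apply: measurable_sum => n.
exact: (measurableT_comp measurable_ipw_term).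
Qed.

(** The deviation 6 r on the scale [c / pi_low] has tail
exp(- N r^2) = delta. *)
Lemma ipw_estimator_tail (d : measure_display) (Omega : measurableType d)
    (P : probability Omega R) (N : nat) (D : 'I_N -> {RV P >-> outcome R p q})
    (m c delta : R) :
  (0 < N)%N -> iid_sample Pbar D -> 0 < c -> 0 < delta -> delta < 1 ->
  (\int[Pbar]_y (l (xi_of y))%:E = m%:E)%E ->
  (\int[Pbar]_y (expR ((l (xi_of y) / c) ^+ 2))%:E <= 2%:E)%E ->
  ((1 - delta)%:E <= P [set w | m - ipw_estimator pol (fun n => D n w) l <=
    6 * (c / pi_low) * Num.sqrt (ln (1 / delta) / N%:R)]%R)%E.
Proof.
move=> N0 iidD c0 delta0 delta1 lm lc.
have NR0 : 0 < N%:R :> R by rewrite ltr0n.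
set r := Num.sqrt _; set G := [set w | _]; set s := c / pi_low.
have s0 : 0 < s by rewrite divr_gt0.
have mf : measurable_fun [set: outcome R p q] (fun y => ipw_term y / s).
  by apply: measurable_funM => //; exact: measurable_ipw_term.
have fm : (\int[Pbar]_y (ipw_term y / s)%:E = (m / s)%:E)%E.
  have [intf _] := subgaussian_integrable mf (ipw_term_subgaussian c0 lc).
  have [i iE] : exists i, (\int[Pbar]_y (ipw_term y / s)%:E)%E = i%:E.
    by exists (fine (\int[Pbar]_y (ipw_term y / s)%:E)%E); rewrite fineK//;
      exact: integrable_fin_num intf.
  have : (\int[Pbar]_y (ipw_term y)%:E = s%:E * i%:E)%E.
    rewrite -iE -integralZl//; apply: eq_integral => y _.
    by rewrite -EFinM mulrC divfK ?gt_eqF.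
  rewrite integral_ipw_term lm iE -EFinM => -[->].
  by rewrite mulrAC mulfV ?gt_eqF// mul1r.
have := subgaussian_sample_mean_tail (x := 6 * r) iidD N0 mf
  (ipw_term_subgaussian c0 lc) fm.
set A := [set t | _].
have -> : - (N%:R * (6 * r) ^+ 2 / 36) = ln delta.
  rewrite exprMn sqr_sqrtr; last first.
    by rewrite divr_ge0 ?ln_ge0 ?ler0n// div1r invf_ge1// ltW.
  by rewrite div1r lnV ?posrE//; field; rewrite gt_eqF.
rewrite lnK ?posrE// => PA.
have {}PA := PA (mulr_ge0 (ler0n _ 6) (sqrtr_ge0 _)).
have mA : measurable A.
  rewrite -[A]setTI; apply: measurable_fun_le => //.
  apply: measurable_funB => //; apply: measurable_funM => //.
  by apply: measurable_sum => n; exact: (measurableT_comp mf).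
have mG : measurable G.
  rewrite -[G]setTI; apply: measurable_fun_le => //.
  by apply: measurable_funB => //; exact: measurable_ipw_estimator.
have sub : ~` A `<=` G.
  move=> w /negP; rewrite -ltNge /G /= => /ltW wA.
  have -> : m - ipw_estimator pol (fun n => D n w) l =
      s * (m / s - N%:R^-1 * \sum_(n < N) ipw_term (D n w) / s).
    rewrite -mulr_suml /ipw_estimator -/(ipw_term _).
    by field; rewrite !gt_eqF.
  have -> : 6 * (c / pi_low) * r = s * (6 * r) by rewrite -/s; ring.
  by rewrite ler_pM2l.
apply: (@le_trans _ _ (P (~` A))).
  by rewrite probability_setC// EFinB leeB.
by apply: le_measure; rewrite ?inE//; exact: measurableC.
Qed.
End ipw_concentration.

Theorem proposition6 (R : realType) :
  exists C_IPW : R, 0 < C_IPW /\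
  forall (Dx p q J : nat) (X : set 'cV[R]_Dx)
    (a : 'I_J.+1 -> 'cV[R]_Dx -> 'cV[R]_(p + q))
    (b : 'I_J.+1 -> 'cV[R]_Dx -> R)
    (chi_space : set (p.-tuple R))
    (Pbar : probability (outcome R p q) R)
    (pol : p.-tuple R -> R) (pi_low sigma : R)
    (d : measure_display) (Omega : measurableType d)
    (P : probability Omega R)
    (N : nat) (D : 'I_N -> {RV P >-> outcome R p q}),
  let Pstar := distribution Pbar (@xi_of R p q) in
  let ell := max_affine_loss a b in
  compact X -> convex_set X ->
  (forall j, is_affine (a j)) ->
  (forall j, is_affine (b j : 'cV[R]_Dx -> R^o)) ->
  {ae Pbar, forall y, chi_space (chi_of y)} ->
  is_cond_prob Pbar [set y | sel y = true] (@chi_of R p q) pol ->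
  cond_independent Pbar (@omega_of R p q) (@sel R p q) (@chi_of R p q) ->
  0 < pi_low -> (forall c, chi_space c -> pi_low <= pol c) ->
  (0 < N)%N -> iid_sample Pbar D ->
  (forall z, X z -> (psi2_norm Pstar (ell z) <= sigma%:E)%E) ->
  forall (z : 'cV[R]_Dx) (delta : R), X z -> 0 < delta -> delta < 1 ->
  ((1 - delta)%:E <=
    P [set w | 'E_Pstar[ell z] -
                 (ipw_estimator pol (fun n => D n w) (ell z))%:E <=
               (C_IPW * (sigma / pi_low) *
                Num.sqrt (ln (1 / delta) / N%:R))%:E])%E.
Proof.
exists 6; split=> // Dx p q J X a b chi_space Pbar pol pi_low sigma d Omega P.
move=> N D Pstar ell _ _ _ _ chi_ae polP indep pi_low0 pol_ge N0 iidD psi.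
move=> z delta Xz delta0 delta1.
have ml : measurable_fun [set: uncertainty R p q] (ell z).
  exact: measurable_max_affine_loss.
have mlxi : measurable_fun [set: outcome R p q] (fun y => ell z (xi_of y)).
  exact: (measurableT_comp ml measurable_snd).
have pol_ae : {ae Pbar, forall y, pi_low <= pol (chi_of y)}.
  by apply: filterS chi_ae => y; exact: pol_ge.
have sigma0 : 0 <= sigma.
  by rewrite -lee_fin (le_trans (psi2_norm_ge0 Pstar (ell z))) ?psi.
have subg c : sigma < c ->
    (\int[Pbar]_y (expR ((ell z (xi_of y) / c) ^+ 2))%:E <= 2%:E)%E.
  move=> sc; have := psi2_norm_lt ml (psi z Xz) sc.
  rewrite ge0_integral_pushforward//.
  apply/measurable_EFinP; apply: measurableT_comp => //.
  by apply: measurable_funX; exact: measurable_funM.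
pose r := Num.sqrt (ln (1 / delta) / N%:R).
pose dev m w := m - ipw_estimator pol (fun n => D n w) (ell z).
have [m lm Em] : exists2 m, (\int[Pbar]_y (ell z (xi_of y))%:E)%E = m%:E &
    ('E_Pstar[ell z] = m%:E)%E.
  (* any constant above sigma serves to get integrability of the loss *)
  pose c := sigma + 1.
  have c0 : 0 < c by rewrite ltr_wpDl.
  have sc : sigma < c by rewrite ltrDl.
  have mlc : measurable_fun [set: outcome R p q]
    (fun y => ell z (xi_of y) / c) by exact: measurable_funM.
  have [intlc _] := subgaussian_integrable mlc (subg c sc).
  have intl : Pbar.-integrable [set: outcome R p q]
      (fun y => (ell z (xi_of y))%:E).
    have := integrableZl measurableT c intlc.
    by apply: eq_integrable => // y _; rewrite -EFinM mulrC divfK ?gt_eqF.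
  exists (fine (\int[Pbar]_y (ell z (xi_of y))%:E)%E).
    by rewrite fineK//; exact: integrable_fin_num intl.
  rewrite fineK; last exact: integrable_fin_num intl.
  by rewrite unlock integral_pushforward//; exact/measurable_EFinP.
pose K := 6 / pi_low * r.
have K0 : 0 <= K by rewrite mulr_ge0 ?divr_ge0 ?sqrtr_ge0// ltW.
have boundE h : 6 * ((sigma + h) / pi_low) * r =
    6 * (sigma / pi_low) * r + K * h by rewrite /K; ring.
(* good events for the constants sigma + 1 / (k + 1), which decrease to the
   good event for sigma *)
pose F k := [set w | dev m w <= 6 * ((sigma + harmonic k) / pi_low) * r].
have PF k : ((1 - delta)%:E <= P (F k))%E.
  have h0 : 0 < (harmonic k : R) by rewrite /harmonic/= invr_gt0.
  apply: (ipw_estimator_tail polP indep pi_low0 pol_ae ml N0 iidD) => //.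
    by rewrite ltr_wpDl.
  by apply: subg; rewrite ltrDl.
have mF k : measurable (F k).
  rewrite -[F k]setTI; apply: measurable_fun_le => //.
  by apply: measurable_funB => //; exact: (measurable_ipw_estimator polP ml).
have Fcap : [set w | ('E_Pstar[ell z] -
      (ipw_estimator pol (fun n => D n w) (ell z))%:E <=
      (6 * (sigma / pi_low) * r)%:E)%E] = \bigcap_k F k.
  rewrite Em; apply/seteqP; split => w /=.
    rewrite -EFinB lee_fin => wsigma k _; rewrite /F/= boundE.
    by rewrite (le_trans wsigma)// lerDl mulr_ge0// harmonic_ge0.
  move=> wF; rewrite -EFinB lee_fin.
  have cvgB : 6 * (sigma / pi_low) * r + K * harmonic k @[k --> \oo] -->
      6 * (sigma / pi_low) * r.
    rewrite -[X in _ --> X]addr0 -[X in _ + X](mulr0 K).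
    by apply: cvgD; [exact: cvg_cst|apply: cvgMr; exact: cvg_harmonic].
  rewrite -(cvg_lim _ cvgB)//; apply: limr_ge; first exact: cvgP cvgB.
  by apply: nearW => k; rewrite -boundE; exact: wF.
rewrite Fcap.
have cvgF : P (F k) @[k --> \oo] --> P (\bigcap_k F k).
  apply: nonincreasing_cvg_mu => //.
  - by rewrite (le_lt_trans (probability_le1 _ _)) ?ltry.
  - exact: bigcap_measurable.
  - move=> i j ij; apply/subsetPset => w; rewrite /F /= => /le_trans; apply.
    by rewrite !boundE lerD2l ler_wpM2l// lef_pV2 ?posrE// ler_nat ltnS.
rewrite -(cvg_lim _ cvgF)//; apply: lime_ge; first exact: cvgP cvgF.
exact: nearW.
Qed.
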